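(* Let $n$ and $k$ be positive integers and let $a_1,\dots,a_n$ be bounded self-adjoint operators acting on an infinite dimensional Hilbert space $H$. Then there are real numbers $t_1,\dots,t_n$ and a projection $p$ on $H$ of rank $k$ such that $$p a_i p = t_i p, \qquad 1\le i\le n.$$
   Context: Hilbert spaces are complex, and ''projection'' means orthogonal projection (a bounded operator $p$ with $p=p^*=p^2$); its rank is the dimension of its range. *)

(* Defs.v *)
From HB Require Import structures.
From mathcomp Require Import all_boot all_order all_algebra.
From mathcomp Require Import all_classical all_reals topology normedtype.
From mathcomp Require Import complex.

Set Implicit Arguments.
Unset Strict Implicit.
Unset Printing Implicit Defensive.

Import Order.TTheory GRing.Theory Num.Theory.
Import numFieldNormedType.Exports.

Local Open Scope classical_set_scope.
Local Open Scope ring_scope.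

Section Dimension.
Variables (K : fieldType) (V : lmodType K).

Definition lin_indep k (e : 'I_k -> V) : Prop :=
  forall c : 'I_k -> K, \sum_(i < k) c i *: e i = 0 -> forall i, c i = 0.

Definition lin_span k (e : 'I_k -> V) : set V :=
  range (fun c : 'I_k -> K => \sum_(i < k) c i *: e i).

Definition has_dim (S : set V) (k : nat) : Prop :=
  exists2 e : 'I_k -> V, lin_indep e & S = lin_span e.

End Dimension.

Definition infinite_dimensional (K : fieldType) (V : lmodType K) : Prop :=
  forall k, ~ has_dim [set: V] k.

(* A complex Hilbert space over R : realType is a completeNormedModType R[i]
   whose norm comes from an inner product, given as a form
   dot : {dot H for Num.conj} (linear in its first argument). *)
Section Operators.
Variables (R : realType) (H : completeNormedModType R[i]).
Implicit Types (dot : {dot H for Num.conj}) (a b p : {linear H -> H}).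

Definition induces_norm dot : Prop := forall x : H, `|x| ^+ 2 = dot x x.

(* By linear_boundedP, this says that |a x| <= M |x| for some M and all x. *)
Definition bounded_operator a : Prop := bounded_near a (nbhs (0 : H)).

Definition is_adjoint dot a b : Prop :=
  forall x y : H, dot (a x) y = dot x (b y).

Definition selfadjoint dot a : Prop := is_adjoint dot a a.

Definition projection dot p : Prop :=
  [/\ bounded_operator p, selfadjoint dot p & p \o p =1 p].

Definition has_rank a (k : nat) : Prop := has_dim (range a) k.

End Operators.

(* Main.v *)
From HB Require Import structures.
Require Import Defs.
From mathcomp Require Import all_boot all_order all_algebra.
From mathcomp Require Import all_classical all_reals topology normedtype.
From mathcomp Require Import complex.
From mathcomp Require Import ring zify.
Import numFieldNormedType.Exports.
Local Open Scope ring_scope.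
Local Open Scope complex_scope.
Import Order.TTheory GRing.Theory Num.Theory.

(** If [e_0, ..., e_(k-1)] are orthonormal and, for every operator [a i], the
    matrix [dot (a i (e_j)) (e_l)] is the scalar matrix [t i], then the
    orthogonal projection onto their span compresses each [a i] to [t i]
    ([span_projection_compression]). So the task is to find such vectors.

    Infinite dimension makes all these matrices diagonal at once. A nonzero
    vector orthogonal to any given finite list of vectors exists, so each new
    unit vector can be taken orthogonal to all earlier [e_j] and all earlier
    [a i (e_j)]; self-adjointness then kills the entries on both sides of the
    diagonal ([simultaneously_diagonal]). Diagonal systems of every finite
    length are available, and self-adjointness makes the diagonal entries real.

    The diagonals are made constant one operator at a time, each time halving
    the length of the system ([constant_diagonals]). Sort the [2N] diagonal
    entries of one operator and let [t] be a median; the [m]-th smallest entry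
    and the [N + m]-th one enclose [t], so [t] is a convex combination
    [u ^+ 2 * x + v ^+ 2 * y] of them, and the vector [u e + v e'] built on the
    corresponding pair has diagonal entry exactly [t]. As the pairs are disjoint,
    the [N] new vectors are again orthonormal and every operator stays diagonal
    on them, with convex combinations of old entries as its new entries; hence
    the diagonals that were already constant keep their value
    ([diagonal_on_pair_combination]). *)

(** * Infinite dimension and common zeros of functionals *)

Section Dim.
Context {K : fieldType} {V : lmodType K}.

Lemma lin_indep_extend k (e : 'I_k -> V) (x : V) :
  lin_indep e -> ~ lin_span e x ->
  lin_indep (fun i : 'I_k.+1 => oapp e x (unlift ord0 i)).
Proof.
move=> e_free xNe c; rewrite big_ord_recl unlift_none /=.
under eq_bigr => i _ do rewrite liftK /=.
move=> c_eq0.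
have c0 : c ord0 = 0.
  apply/eqP/negPn/negP => c0N0; apply: xNe.
  exists (fun i => - (c ord0)^-1 * c (lift ord0 i)) => //.
  under eq_bigr => i _ do rewrite -scalerA.
  rewrite -scaler_sumr; move/eqP: c_eq0; rewrite addrC addr_eq0 => /eqP ->.
  by rewrite scalerN scaleNr opprK scalerA mulVf ?scale1r.
move: c_eq0; rewrite c0 scale0r add0r => /e_free ce i.
by case: (unliftP ord0 i) => [j|] ->.
Qed.

(** Infinite dimension is given as the absence of finite bases. A free family
    that cannot be extended would be one, so free families of every length
    exist. *)
Lemma infinite_dimensional_free k :
  infinite_dimensional V -> exists e : 'I_k -> V, lin_indep e.
Proof.
move=> Vinf; elim: k => [|k [e e_free]].
  by exists (fun=> 0) => c _ [].
have [x xNe] : exists x, ~ lin_span e x.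
  apply/existsNP => eV; apply: (Vinf k); exists e => //.
  by apply/seteqP; split=> x _ //; exact: eV.
by eexists; exact: lin_indep_extend e_free xNe.
Qed.

(** The values of the [m] functionals on [m + 1] free vectors form a matrix with
    more rows than columns, so some nontrivial combination of its rows is zero;
    the same combination of the vectors is the required common zero. *)
Lemma functionals_common_zero m (f : 'I_m -> V -> K) :
  (forall j, linear_for *%R (f j)) ->
  infinite_dimensional V -> exists2 x : V, x != 0 & forall j, f j x = 0.
Proof.
move=> f_lin /(infinite_dimensional_free m.+1) [e e_free].
pose M := \matrix_(i < m.+1, j < m) f j (e i).
have [u uN0 uM] : exists2 u : 'rV_m.+1, u != 0 & u *m M = 0.
  have /rowV0Pn[u /sub_kermxP uM uN0] : kermx M != 0.
    by rewrite kermx_eq0 /row_free neq_ltn ltnS rank_leq_col.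
  by exists u.
exists (\sum_i u 0 i *: e i).
  apply: contraNneq uN0 => /e_free u0.
  by apply/eqP/rowP => i; rewrite u0 mxE.
move=> j; have /matrixP/(_ 0 j) := uM; rewrite !mxE => <-.
pose F := GRing.isLinear.Build _ _ _ _ _ (f_lin j).
pose g : {linear V -> K | *%R} := HB.pack (f j) F.
rewrite -[f j]/(g : V -> K) linear_sum.
by apply: eq_bigr => i _; rewrite linearZ /= mxE.
Qed.

End Dim.

(** * Balancing real numbers *)

Section Pairing.

(** With [s] enumerating the indices by increasing value of [d], the pairs
    [(s m, s (N + m))] for [m < N] are disjoint and all straddle the upper
    median [t = d (s N)]. *)
Lemma median_pairing {F : realDomainType} (d : nat -> F) (N : nat) :
  exists (t : F) (s : nat -> nat),
    [/\ forall j, (j < N + N)%N -> (s j < N + N)%N,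
        forall j l, (j < N + N)%N -> (l < N + N)%N -> (s j == s l) = (j == l)
      & forall m, (m < N)%N -> d (s m) <= t <= d (s (N + m)%N)].
Proof.
pose r := relpre d <=%O : rel nat.
have r_total : total r by move=> x y; exact: le_total.
have r_trans : transitive r by move=> x y z; exact: le_trans.
have r_refl : reflexive r by move=> x; exact: lexx.
pose q := sort r (iota 0 (N + N)).
have qsz : size q = (N + N)%N by rewrite size_sort size_iota.
have q_uniq : uniq q by rewrite sort_uniq iota_uniq.
have qd j l : (j <= l)%N -> (l < N + N)%N -> d (nth 0 q j) <= d (nth 0 q l).
  move=> jl lN; apply: (sorted_leq_nth r_trans r_refl 0%N (sort_sorted r_total _)) => //.
    by rewrite inE /= qsz (leq_ltn_trans jl).
  by rewrite inE /= qsz.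
exists (d (nth 0%N q N)), (nth 0%N q); split.
- move=> j jN; have : nth 0%N q j \in q by rewrite mem_nth ?qsz.
  by rewrite mem_sort mem_iota.
- by move=> j l jN lN; rewrite nth_uniq ?qsz.
- by move=> m mN; rewrite !qd //; lia.
Qed.

(** The weights of the convex combination are written as squares because they
    will be the squared lengths of the components of a unit vector. *)
Lemma convex_sqr {F : rcfType} (x t y : F) : x <= t <= y ->
  exists w : F * F, w.1 ^+ 2 + w.2 ^+ 2 = 1 /\ w.1 ^+ 2 * x + w.2 ^+ 2 * y = t.
Proof.
case/andP=> xt ty; have [xy|yx] := ltP x y; last first.
  have -> : t = x by apply/le_anti; rewrite xt (le_trans ty yx).
  by exists (1, 0) => /=; split; ring.
have yx0 : 0 < y - x by rewrite subr_gt0.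
exists (Num.sqrt ((y - t) / (y - x)), Num.sqrt ((t - x) / (y - x))) => /=.
by rewrite !sqr_sqrtr ?divr_ge0 ?subr_ge0 ?(ltW xy) //; split; field; rewrite gt_eqF.
Qed.

End Pairing.

(** * Systems on which operators are diagonal *)

Section Hilb.
Context {R : realType} {H : completeNormedModType R[i]}.
Context (dot : {dot H for Num.conj}).
Implicit Types (b p : {linear H -> H}) (e f : nat -> H).

Lemma dotC x y : dot x y = (dot y x)^*%R.
Proof. by rewrite hermC expr0 mul1r. Qed.

Lemma selfadjoint_dot_real b x : selfadjoint dot b ->
  dot (b x) x = (complex.Re (dot (b x) x))%:C.
Proof.
by move=> b_sa; rewrite RRe_real // CrealE -dotC b_sa.
Qed.

Lemma unit_vector_orthogonal (vs : seq H) : infinite_dimensional H ->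
  exists x : H, dot x x = 1 /\ {in vs, forall v, dot x v = 0}.
Proof.
move=> Hinf.
have [j|x xN0 xvs] := @functionals_common_zero _ H (size vs)
   (fun j x => dot x (tnth (in_tuple vs) j)) _ Hinf.
  by move=> c x y; rewrite linearPl.
exists (sqrtC (dot x x)^-1 *: x); split; last first.
  by move=> v /(tnthP (in_tuple vs))[j ->]; rewrite linearZl_LR /= xvs mulr0.
have x_gt0 : 0 < dot x x by rewrite dnorm_gt0.
rewrite dnormZ ger0_norm ?sqrtC_ge0 ?invr_ge0 ?(ltW x_gt0) //.
by rewrite sqrtCK mulVf ?gt_eqF.
Qed.

(** The entries are indexed by [nat] and only constrained below [N], so that a
    system can be lengthened, re-indexed and paired without casts between
    ordinals. *)
Definition diagonal_on (N : nat) e b (d : nat -> R) := forall j l,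
  (j < N)%N -> (l < N)%N -> dot (b (e j)) (e l) = ((j == l)%:R * d j)%:C.

(** Seeing the Gram matrix as the case of the identity operator lets a single
    lemma transport both orthonormality and diagonality. *)
Definition orthonormal_on N e := diagonal_on N e idfun (fun=> 1).

(** Greedy construction. The new unit vector [x] is orthogonal to each earlier
    [e j] and [a i (e j)]; then [dot (a i x) (e j) = dot x (a i (e j)) = 0], and
    [dot (a i (e j)) x] is its conjugate. *)
Lemma simultaneously_diagonal {I : finType} (a : I -> {linear H -> H}) N :
  infinite_dimensional H -> (forall i, selfadjoint dot (a i)) ->
  exists e (d : I -> nat -> R),
    orthonormal_on N e /\ forall i, diagonal_on N e (a i) (d i).
Proof.
move=> Hinf a_sa.
suff [e [e1 ea]] : exists e, (forall j l, (j < N)%N -> (l < N)%N ->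
      dot (e j) (e l) = (j == l)%:R) /\ (forall i j l, (j < N)%N -> (l < N)%N ->
      j != l -> dot (a i (e j)) (e l) = 0).
  exists e, (fun i j => complex.Re (dot (a i (e j)) (e j))).
  split=> [j l jN lN|i j l jN lN].
    by rewrite e1 // mulr1 rmorph_nat.
  have [<-|jl] := eqVneq j l; first by rewrite mul1r -selfadjoint_dot_real.
  by rewrite ea // mul0r rmorph0.
elim: N => [|N [e [e1 ea]]]; first by exists (fun=> 0).
have [x [x1 xvs]] := unit_vector_orthogonal
  (map e (iota 0 N) ++ [seq a i (e j) | i <- enum I, j <- iota 0 N]) Hinf.
have xe j : (j < N)%N -> dot x (e j) = 0.
  by move=> jN; rewrite xvs // mem_cat map_f // mem_iota.
have xae i j : (j < N)%N -> dot x (a i (e j)) = 0.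
  move=> jN; rewrite xvs // mem_cat; apply/orP; right.
  by apply: (allpairs_f (fun i j => a i (e j))); rewrite ?mem_enum ?mem_iota.
exists (fun j => if j == N then x else e j); split=> [j l|i j l];
  rewrite !ltnS (leq_eqVlt j) (leq_eqVlt l).
  case: (eqVneq j N) => [->|jN] /=; case: (eqVneq l N) => [->|lN] //= jN' lN'.
  - by rewrite xe.
  - by rewrite dotC xe // rmorph0 (negPf jN).
  - exact: e1.
case: (eqVneq j N) => [->|jN] /=; case: (eqVneq l N) => [->|lN] //= jN' lN' jl.
- by rewrite a_sa xae.
- by rewrite dotC xae // rmorph0.
- exact: ea.
Qed.

Definition pair_combination N (s : nat -> nat) (w : nat -> R * R) e m :=
  (w m).1%:C *: e (s m) + (w m).2%:C *: e (s (N + m)%N).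

(** Distinct combinations involve disjoint sets of the old vectors, so no
    off-diagonal entry appears; the cross terms inside one pair vanish because
    they are off-diagonal for the old system. *)
Lemma diagonal_on_pair_combination N (s : nat -> nat) (w : nat -> R * R) e b d :
  (forall j, (j < N + N)%N -> (s j < N + N)%N) ->
  (forall j l, (j < N + N)%N -> (l < N + N)%N -> (s j == s l) = (j == l)) ->
  diagonal_on (N + N) e b d ->
  diagonal_on N (pair_combination N s w e) b
    (fun m => (w m).1 ^+ 2 * d (s m) + (w m).2 ^+ 2 * d (s (N + m)%N)).
Proof.
move=> s_lt s_inj ebd j l jN lN.
have jN1 : (j < N + N)%N by lia.
have lN1 : (l < N + N)%N by lia.
have jN2 : (N + j < N + N)%N by lia.
have lN2 : (N + l < N + N)%N by lia.
rewrite /pair_combination [b _]linearD 2![b _]linearZ /= linearDl !linearDr /=.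
rewrite !linearZl_LR /= !linearZr_LR /= !ebd ?s_lt // !s_inj // eqn_add2l.
have -> : (j == N + l)%N = false by lia.
have -> : (N + j == l)%N = false by lia.
have conjR (c : R) : Num.conj (c%:C) = c%:C by exact: conjc_real.
rewrite /= !conjR -!rmorphM -!rmorphD /=.
by have [->|_] := eqVneq j l; congr (_%:C) => /=; ring.
Qed.

(** Induction on the list of operators whose diagonal is already constant. The
    length [N] stays universally quantified: a system of length [N] for one more
    operator comes from a system of length [2N] for the previous ones. *)
Lemma constant_diagonals {I : finType} (a : I -> {linear H -> H}) (s0 : seq I) N :
  infinite_dimensional H -> (forall i, selfadjoint dot (a i)) ->
  exists e (d : I -> nat -> R),
    [/\ orthonormal_on N e, forall i, diagonal_on N e (a i) (d i) &
        {in s0, forall i, exists t, forall j, (j < N)%N -> d i j = t}].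
Proof.
move=> Hinf a_sa; elim: s0 N => [|i0 s0 IH] N.
  by have [e [d [e1 ead]]] := simultaneously_diagonal a N Hinf a_sa; exists e, d.
have [e [d [e1 ead dt]]] := IH (N + N)%N.
have [t [s [s_lt s_inj dts]]] := median_pairing (d i0) N.
have /choice[w wP] : forall m, exists w : R * R, (m < N)%N ->
    w.1 ^+ 2 + w.2 ^+ 2 = 1 /\
    w.1 ^+ 2 * d i0 (s m) + w.2 ^+ 2 * d i0 (s (N + m)%N) = t.
  move=> m; case: (ltnP m N) => [mN|_]; last by exists 0.
  by have [w ?] := convex_sqr _ _ _ (dts m mN); exists w.
exists (pair_combination N s w e),
  (fun i m => (w m).1 ^+ 2 * d i (s m) + (w m).2 ^+ 2 * d i (s (N + m)%N)).
split=> [j l jN lN|i|i].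
- rewrite (diagonal_on_pair_combination _ _ w _ _ _ s_lt s_inj e1) //.
  by rewrite !mulr1 (wP j jN).1 mulr1.
- exact: (diagonal_on_pair_combination _ _ _ _ _ _ s_lt s_inj (ead i)).
rewrite inE => /predU1P[->|/dt[t' dt']].
  by exists t => m /wP[].
exists t' => m mN; rewrite !dt' ?s_lt //; try lia.
by rewrite -mulrDl (wP m mN).1 mul1r.
Qed.

(** * The projection onto an orthonormal system *)

Section Projection.
Variables (k : nat) (e : nat -> H).
Hypothesis e1 : orthonormal_on k e.

Definition span_projection (x : H) : H := \sum_(m < k) dot x (e m) *: e m.

Fact span_projection_is_linear : linear span_projection.
Proof.
move=> c x y; rewrite /span_projection scaler_sumr -big_split /=.
by apply: eq_bigr => m _; rewrite linearPl /= scalerDl scalerA.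
Qed.

HB.instance Definition _ :=
  GRing.isLinear.Build _ _ _ _ span_projection span_projection_is_linear.

Lemma dot_sum_l (c : 'I_k -> R[i]) (m : 'I_k) :
  dot (\sum_(l < k) c l *: e l) (e m) = c m.
Proof.
rewrite linear_sumlz (bigD1 m) //= big1 => [|l lm]; rewrite linearZl_LR /=.
  by rewrite e1 // eqxx mul1r addr0 mulr1.
by rewrite e1 // (negPf (lm : val l != val m)) mul0r mulr0.
Qed.

Lemma span_projection_selfadjoint : selfadjoint dot span_projection.
Proof.
move=> x y; rewrite linear_sumlz linear_sumr; apply: eq_bigr => m _.
by rewrite linearZl_LR linearZr_LR /= -dotC mulrC.
Qed.

Lemma span_projection_idem x : span_projection (span_projection x) = span_projection x.
Proof. by apply: eq_bigr => m _; rewrite dot_sum_l. Qed.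

(** By Pythagoras, [x] being the sum of [span_projection x] and a vector
    orthogonal to it, the projection does not increase the norm. *)
Lemma span_projection_bounded : induces_norm dot -> bounded_operator span_projection.
Proof.
move=> dotN; apply/linear_boundedP.
have p_le x : `|span_projection x| <= `|x|.
  rewrite -(@ler_pXn2r _ 2) ?nnegrE // !dotN.
  have pyth : dot (span_projection x) (x - span_projection x) = 0.
    rewrite span_projection_selfadjoint linearB /= span_projection_idem.
    by rewrite subrr linear0r.
  rewrite [leRHS](_ : _ = dot (span_projection x) (span_projection x) +
      dot (x - span_projection x) (x - span_projection x)).
    by rewrite lerDl dnorm_ge0.
  by rewrite -hnormDd // addrC subrK.
by near=> r => x; rewrite (le_trans (p_le x)) // ler_peMl //.
Unshelve. all: by end_near. Qed.

Lemma span_projection_projection :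
  induces_norm dot -> projection dot span_projection.
Proof.
split; [exact: span_projection_bounded|exact: span_projection_selfadjoint|].
exact: span_projection_idem.
Qed.

Lemma span_projection_rank : has_rank span_projection k.
Proof.
exists (fun m : 'I_k => e m) => [c c0 m|].
  by rewrite -(dot_sum_l c) c0 linear0l.
apply/seteqP; split=> x [].
  by move=> y _ <-; exists (fun m : 'I_k => dot y (e m)).
move=> c _ <-; exists (\sum_(m < k) c m *: e m) => //.
by apply: eq_bigr => m _; rewrite dot_sum_l.
Qed.

(** The compression of [b] has [dot (b (e l)) (e m)] as its matrix in the
    orthonormal system, so it is scalar as soon as that matrix is. *)
Lemma span_projection_compression b (t : R) : diagonal_on k e b (fun=> t) ->
  span_projection \o b \o span_projection =1 (fun x => t%:C *: span_projection x).
Proof.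
move=> ebt x; rewrite /= /span_projection scaler_sumr.
apply: eq_bigr => m _; rewrite scalerA; congr (_ *: _).
rewrite linear_sum linear_sumlz (bigD1 m) //= big1 => [|l lm].
  by rewrite linearZ linearZl_LR /= ebt // eqxx mul1r addr0 mulrC.
by rewrite linearZ linearZl_LR /= ebt // (negPf (lm : val l != val m)) mul0r mulr0.
Qed.

End Projection.
End Hilb.

Theorem theorem1p8 (R : realType) (H : completeNormedModType R[i])
    (dot : {dot H for Num.conj}) (n k : nat) (a : 'I_n -> {linear H -> H}) :
  induces_norm dot ->
  infinite_dimensional H ->
  (0 < n)%N -> (0 < k)%N ->
  (forall i, bounded_operator (a i)) ->
  (forall i, selfadjoint dot (a i)) ->
  exists (t : 'I_n -> R) (p : {linear H -> H}),
    [/\ projection dot p,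
        has_rank p k &
        forall i, p \o a i \o p =1 (fun x => (t i)%:C *: p x)].
Proof.
move=> dotN Hinf _ _ _ a_sa.
have [e [d [e1 ead dt]]] := constant_diagonals dot a (enum 'I_n) k Hinf a_sa.
have /choice[t tP] : forall i, exists t, forall j, (j < k)%N -> d i j = t.
  by move=> i; apply: dt; rewrite mem_enum.
exists t, (span_projection dot k e); split.
- exact: span_projection_projection.
- exact: span_projection_rank.
- move=> i; apply: span_projection_compression => // j l jk lk.
  by rewrite ead // tP.
Qed.
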